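(* Let $(X,T)$ be a topological dynamical system, $\mu\in M(X,T)$ and $f\in L^2(\mu)$. If there exists a subsequence $A=\{a_i:i\in\mathbb{N}\}$ of $\mathbb{N}$ with $\bar{D}(A)>0$ such that $f$ is $\mu$-$A$-mean-equicontinuous, then $f$ is rigid.
   Context: A topological dynamical system $(X,T)$ is a non-empty compact metric space $X$ with metric $d$ together with a homeomorphism $T:X\to X$. $M(X,T)$ is the set of $T$-invariant regular Borel probability measures on $X$. $\mathbb{N}=\{0,1,2,\dots\}$. A subsequence $A=\{a_i:i\in\mathbb{N}\}$ of $\mathbb{N}$ is an infinite set of natural numbers listed in strictly increasing order $a_0<a_1<\cdots$. Its upper density is $\bar{D}(A)=\limsup_{n\to\infty}\frac{|A\cap[0,n-1]|}{n}$. $f\in L^2(\mu)$ is rigid if there is a subsequence $\{t_k\}$ of $\mathbb{N}$ (possibly depending on $f$) such that $f\circ T^{t_k}\to f$ in $L^2(\mu)$. For $x,y\in X$ and $n\geq 1$ let $\bar{d}_{n,f}^A(x,y)=\frac1n\sum_{i=0}^{n-1}|f(T^{a_i}x)-f(T^{a_i}y)|$ (with $f$ evaluated pointwise through a representative). A subset $K\subset X$ is $f$-$A$-mean-equicontinuous if for every $\epsilon>0$ there is $\delta>0$ such that for all $x,y\in K$ with $d(x,y)<\delta$ one has $\limsup_{n\to\infty}\bar{d}_{n,f}^A(x,y)<\epsilon$. $f$ is $\mu$-$A$-mean-equicontinuous if for every $\tau>0$ there is a compact $f$-$A$-mean-equicontinuous set $K\subset X$ with $\mu(K)>1-\tau$.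 *)

(* Defs.v *)
From HB Require Import structures.
From mathcomp Require Import all_boot all_order all_algebra.
From mathcomp Require Import all_classical all_reals all_analysis.
From mathcomp Require Export complex.

Set Implicit Arguments.
Unset Strict Implicit.
Unset Printing Implicit Defensive.
Import Order.TTheory GRing.Theory Num.Theory.
Import numFieldNormedType.Exports.

Local Open Scope classical_set_scope.
Local Open Scope ring_scope.

(* Non-empty metric spaces: non-emptiness is a distinguished point, which the
   measurable structures of the library require on their carrier. *)
#[short(type="pmetricType")]
HB.structure Definition PMetric (K : numDomainType) :=
  { M of Metric K M & Pointed M }.

Notation borel X := (g_sigma_algebraType (@open X)).

Definition homeomorphism (X : topologicalType) (T : X -> X) : Prop :=
  exists S : X -> X,
    [/\ cancel T S, cancel S T, continuous T & continuous S].

Section Measures.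
Context {R : realType} {X : pmetricType R}.
Implicit Types (mu : probability (borel X) R) (T : X -> X).

Definition regular_measure mu : Prop :=
  forall B : set X, measurable (B : set (borel X)) ->
    mu B = ereal_inf [set mu U | U in [set U : set X | open U /\ B `<=` U]] /\
    mu B = ereal_sup [set mu K | K in [set K : set X | compact K /\ K `<=` B]].

Definition invariant_measure T mu : Prop :=
  forall B : set X, measurable (B : set (borel X)) -> mu (T @^-1` B) = mu B.

(* M(X, T); every probability on [borel X] is a Borel probability measure *)
Definition invariant_probability T : set (probability (borel X) R) :=
  [set mu | regular_measure mu /\ invariant_measure T mu].

Definition L2norm mu (f : X -> R[i]) : \bar R :=
  Lnorm mu 2%:E (fun x : borel X => (ComplexField.Normc.normc (f x))%:E).

(* [f] is a pointwise Borel representative of an element of complex L^2(mu) *)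
Definition L2 mu : set (X -> R[i]) :=
  [set f | [/\ measurable_fun [set: borel X] (fun x : borel X => complex.Re (f x)),
               measurable_fun [set: borel X] (fun x : borel X => complex.Im (f x))
             & (L2norm mu f < +oo)%E]].

(* A subsequence of nat is given by its increasing enumeration *)
Definition rigid T mu (f : X -> R[i]) : Prop :=
  exists2 t : nat -> nat, increasing_seq t &
    L2norm mu (fun x => f (iter (t k) T x) - f x) @[k --> \oo] --> 0%E.

End Measures.

(* The index n = 0 (where the quotient is 0 / 0 = 0) is irrelevant to the
   upper limit, here and in [mean_equicontinuous_on]. *)
Definition upper_density (R : realType) (A : set nat) : \bar R :=
  limn_esup (fun n : nat =>
    (#|[pred k : 'I_n | (k : nat) \in A]|%:R / n%:R : R)%:E).

Section MeanEquicontinuity.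
Context {R : realType} {X : pmetricType R}.
Implicit Types (T : X -> X) (f : X -> R[i]) (a : nat -> nat).

Definition dbar T f a (n : nat) (x y : X) : R :=
  n%:R^-1 * \sum_(i < n)
    ComplexField.Normc.normc (f (iter (a i) T x) - f (iter (a i) T y)).

Definition mean_equicontinuous_on T f a (K : set X) : Prop :=
  forall eps : R, 0 < eps -> exists2 delta : R, 0 < delta &
    forall x y, K x -> K y -> mdist x y < delta ->
      (limn_esup (fun n => (dbar T f a n x y)%:E) < eps%:E)%E.

Definition mean_equicontinuous T (mu : probability (borel X) R) f a : Prop :=
  forall tau : R, 0 < tau -> exists K : set X,
    [/\ compact K, mean_equicontinuous_on T f a K & ((1 - tau)%:E < mu K)%E].

End MeanEquicontinuity.

(* Main.v *)
Require Import Defs.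
From mathcomp Require Import all_boot all_order all_algebra.
From mathcomp Require Import all_classical all_reals all_analysis.
From mathcomp Require Import measurable_realfun ring lra zify.
Import Order.TTheory GRing.Theory Num.Theory.
Import numFieldNormedType.Exports.
Local Open Scope classical_set_scope.
Local Open Scope ring_scope.
Set Implicit Arguments.
Unset Strict Implicit.

(** Write |.| for the distance in the plane and f o T^k for the k-th iterate of
    the observable.  Since T preserves mu,
      || f o T^(a_j - a_i) - f ||_2 = || f o T^(a_j) - f o T^(a_i) ||_2,
    so f is rigid as soon as, for every e > 0, two functions f o T^(a_i) and
    f o T^(a_j) with j - i arbitrarily large are e-close in L^2: the gaps
    a_j - a_i are then return times ([increasing_selection] arranges them into
    a sequence).  Such pairs come from a precompactness argument.

    Truncating real and imaginary parts at height M changes f by little in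
    L^2, does not increase the distances |f(x) - f(y)|, and makes L^2-closeness
    a consequence of L^1-closeness; so let f be bounded by M
    ([square_integrable_return] performs this reduction).  Take K compact with
    mu(K) close to 1, cover it by finitely many delta-balls with centres in K,
    and let s(x) be a centre within delta of x ([close_center]).  By mean
    equicontinuity the averages over i < n of
    |f(T^(a_i) x) - f(T^(a_i) s(x))| are eventually at most e at each x in K;
    they are bounded and the complement of K has small measure, hence their
    integrals are eventually small too
    ([eventually_le_integral], a reverse Fatou lemma), and therefore the
    integral of the i-th term is small for infinitely many i
    ([frequently_le_of_averages]).  For these i the function f o T^(a_i) is
    L^1-close to the function x |-> f(T^(a_i) s(x)), which is determined by
    the values of f o T^(a_i) at the finitely many centres, that is, by a point
    of a bounded subset of a fixed finite-dimensional space.  By the pigeonhole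
    principle two such points, of distant indices, are close
    ([distant_pair_same_color], applied in [bounded_return]). *)

(** * Averages and pigeonhole *)

(** If all terms from some rank on exceeded twice the eventual bound on the
    averages, so would, up to a finite number of terms, the averages. *)
Lemma frequently_le_of_averages (R : realType) (c : nat -> \bar R) (e : R) :
  0 < e -> (forall i, (0 <= c i)%E) ->
  (\forall n \near \oo, (\sum_(i < n) c i <= (n%:R * e)%:E)%E) ->
  forall N, exists2 i, (N <= i)%N & (c i <= (2 * e)%:E)%E.
Proof.
move=> e0 c0 [n0 _ avg] N; apply: contrapT => nex.
have big i : (N <= i)%N -> ((2 * e)%:E <= c i)%E.
  by move=> Ni; rewrite leNgt; apply/negP => /ltW ci; apply: nex; exists i.
(* beyond 2 N, the terms of index at least N make up more than half the sum *)
pose n := (n0 + N.*2.+1)%N.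
have /avg : (n0 <= n)%N by rewrite leq_addr.
suff : (((n - N)%N%:R * (2 * e))%:E <= \sum_(i < n) c i)%E.
  move=> /le_trans/[apply]; rewrite lee_fin leNgt => /negP; apply.
  rewrite mulrA ltr_pM2r// -natrM ltr_nat /n; lia.
have Nn : (N <= n)%N by rewrite /n; lia.
rewrite -(big_mkord xpredT c) (big_cat_nat _ Nn)//=.
rewrite -[leLHS]add0e leeD ?sume_ge0//.
apply: (@le_trans _ _ (\sum_(N <= i < n) (2 * e)%:E)%E).
  by rewrite sumEFin sumr_const_nat mulr_natl.
rewrite [leLHS]big_nat_cond [leRHS]big_nat_cond; apply: lee_sum => i.
by rewrite andbT => /andP[Ni _]; exact: big.
Qed.

(** More than [#|C|] indices satisfying [P], chosen so that consecutive ones are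
    at distance at least [N], cannot all have distinct colours. *)
Lemma distant_pair_same_color (C : finType) (P : nat -> Prop)
  (color : nat -> C) :
  (forall N, exists2 i, (N <= i)%N & P i) ->
  forall N, exists i j, [/\ P i, P j, color i = color j & (i + N <= j)%N].
Proof.
move=> infP N.
have /choice[next nextP'] : forall n, exists i, (n <= i)%N /\ P i.
  by move=> n; have [j] := infP n; exists j.
have nextge n : (n <= next n)%N by have [] := nextP' n.
have nextP n : P (next n) by have [] := nextP' n.
pose u k := iter k (fun i => next (i + N)%N) (next 0%N).
have uP k : P (u k) by case: k => [|k]; exact: nextP.
have ustep k : (u k + N <= u k.+1)%N by exact: nextge.
have uS : {homo u : k l / (k <= l)%N}.
  apply: homo_leq => [//|y x z|k]; first exact: leq_trans.
  by rewrite (leq_trans _ (ustep k))// leq_addr.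
have ufar k l : (k < l)%N -> (u k + N <= u l)%N.
  by move=> kl; rewrite (leq_trans (ustep k))// uS.
have /injectivePn[k [l kl ckl]] :
    ~~ injectiveb (fun k : 'I_#|C|.+1 => color (u k)).
  by apply/negP => /injectiveP/leq_card; rewrite card_ord ltnn.
have [kl'|lk|/ord_inj/eqP] := ltngtP k l; last by rewrite (negPf kl).
- by exists (u k), (u l); split => //; exact: ufar.
- by exists (u l), (u k); split => //; exact: ufar.
Qed.

(** * A reverse Fatou lemma for bounded functions *)

Section BoundedReverseFatou.
Context d (T : measurableType d) (R : realType) (P : probability T R).

(** Dominated convergence applies to the excess of [F n] over [e], once the
    uncontrolled part outside [K] is removed: there [F n] is at most [B], which
    costs [B * tau] in the integral.  The second [e] absorbs the integral of
    that excess. *)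
Lemma eventually_le_integral (F : nat -> T -> R) (B e tau : R) (K : set T) :
  0 <= B -> 0 < e ->
  (forall n, measurable_fun setT (F n)) ->
  (forall n x, 0 <= F n x <= B) ->
  measurable K -> ((1 - tau)%:E < P K)%E ->
  (forall x, K x -> \forall n \near \oo, F n x <= e) ->
  \forall n \near \oo, (\int[P]_x (F n x)%:E <= (2 * e + B * tau)%:E)%E.
Proof.
move=> B0 e0 mF FB mK PK Fe.
(* [bad] dominates [F n] off [K], so the excess [G n] vanishes there *)
pose bad x := B * \1_(~` K) x.
pose G n x := Num.max (F n x - e - bad x) 0.
have mbad : measurable_fun setT bad.
  by apply: measurable_funM => //; apply: measurable_indic; exact: measurableC.
have bad0 x : 0 <= bad x by rewrite mulr_ge0.
have mG n : measurable_fun setT (G n).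
  by apply: measurable_maxr => //; do 2 apply: measurable_funB => //.
have G0 n x : 0 <= G n x by rewrite le_max lexx orbT.
have GB n x : G n x <= B.
  rewrite ge_max B0 andbT; have /andP[_ Fn] := FB n x.
  by have := bad0 x; lra.
have cvgG x : (G n x)%:E @[n --> \oo] --> 0%E.
  apply: cvg_near_cst; have [Kx|nKx] := pselect (K x).
    near=> n; apply/eqP; rewrite eqe; apply/eqP/max_idPr.
    have : F n x <= e by near: n; exact: Fe.
    by have := bad0 x; lra.
  apply: nearW => n; apply/eqP; rewrite eqe; apply/eqP/max_idPr.
  rewrite /bad indicE mem_set// mulr1; have /andP[_ Fn] := FB n x; lra.
have cvgIG : (\int[P]_x (G n x)%:E)%E @[n --> \oo] --> 0%E.
  rewrite -[X in _ --> X](integral0 P setT).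
  apply: (@dominated_cvg _ _ _ P setT _ _ _ (cst B%:E)) => //.
  - by move=> n; exact/measurable_EFinP.
  - exact: finite_measure_integrable_cst.
  - by move=> n x _ /=; rewrite lee_fin ger0_norm.
have [n0 _ smallG] : \forall n \near \oo, (\int[P]_x (G n x)%:E < e%:E)%E.
  apply: (cvgIG [set y | (y < e%:E)%E]); apply: open_nbhs_nbhs.
  by split; [exact: open_ereal_lt_ereal | rewrite /= lte_fin].
exists n0 => // n n0n.
apply: (@le_trans _ _ (\int[P]_x ((e%:E + (bad x)%:E) + (G n x)%:E))%E).
  apply: ge0_le_integral => //.
  - by move=> x _; rewrite lee_fin; have /andP[] := FB n x.
  - exact/measurable_EFinP.
  - by apply: emeasurable_funD; [apply: emeasurable_funD|] => //;
      exact/measurable_EFinP.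
  - move=> x _; rewrite -!EFinD lee_fin.
    have : F n x - e - bad x <= G n x by rewrite le_max lexx.
    by rewrite -lerBlDl opprD addrA.
rewrite ge0_integralD//; last 4 first.
- by move=> x _; rewrite adde_ge0// lee_fin// ltW.
- by apply: emeasurable_funD => //; exact/measurable_EFinP.
- by move=> x _; rewrite lee_fin.
- exact/measurable_EFinP.
rewrite ge0_integralD//; last 3 first.
- by move=> x _; rewrite lee_fin ltW.
- by move=> x _; rewrite lee_fin.
- exact/measurable_EFinP.
rewrite integral_cst// [X in (e%:E * X)%E](_ : _ = 1%E); last first.
  exact: probability_setT.
rewrite mule1.
under [X in (_ + X + _)%E]eq_integral do rewrite EFinM.
rewrite ge0_integralZl_EFin//; last first.
  by apply/measurable_EFinP/measurable_indic; exact: measurableC.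
rewrite integral_indic//; last exact: measurableC.
rewrite setIT [X in (B%:E * X)%E](_ : _ = P (~` K))//.
have PC : (P (~` K) <= tau%:E)%E.
  rewrite probability_setC//; move: PK.
  have /fineK <- : P K \is a fin_num by exact: fin_num_measure.
  by rewrite -EFinB !lte_fin lee_fin; lra.
rewrite (_ : 2 * e + B * tau = e + B * tau + e); last by ring.
rewrite !EFinD !leeD// ?EFinM ?lee_wpmul2l ?lee_fin//.
exact/ltW/smallG.
Unshelve. all: by end_near.
Qed.

End BoundedReverseFatou.

(** * Borel sets and finite nets in compact metric sets *)

Section Borel.
Context {R : realType} {X : pmetricType R}.

Lemma measurable_open (U : set X) : open U -> measurable (U : set (borel X)).
Proof. by move=> oU; exact: sub_sigma_algebra. Qed.

Lemma measurable_compact (K : set X) :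
  compact K -> measurable (K : set (borel X)).
Proof.
move=> /(compact_closed (@metric_hausdorff _ X)) cK.
rewrite -[K]setCK; apply: measurableC; apply: measurable_open.
exact: closed_openC.
Qed.

Lemma measurable_continuous (T : X -> X) :
  continuous T -> measurable_fun [set: borel X] (T : borel X -> borel X).
Proof.
move=> cT.
apply: (@measurability _ _ (borel X) (borel X) setT T (@open X)) => //.
move=> _ [U oU <-]; rewrite setTI; apply: measurable_open.
by move/continuousP : cT; exact.
Qed.

Lemma open_metric_ball (p : X) (delta : R) : open (ball p delta).
Proof.
rewrite openE => x; rewrite ballEmdist /= => px.
apply: (filterS _ (nbhsx_ballx x (delta - mdist p x) _)); last first.
  by rewrite subr_gt0.
move=> y; rewrite !ballEmdist /= => xy.
by rewrite (le_lt_trans (metric_triangle p x y))// -ltrBrDl.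
Qed.

Lemma compact_finite_net (K : set X) (delta : R) : compact K -> 0 < delta ->
  exists2 ps : seq X, {in ps, forall p, K p} &
    forall x, K x -> exists2 p, p \in ps & mdist p x < delta.
Proof.
move=> + d0; rewrite compact_cover.
case/(_ X K (fun p => ball p delta)).
- by move=> p _; exact: open_metric_ball.
- by move=> x Kx; exists x => //; exact: ballxx.
move=> D DK cover; exists (finmap.enum_fset D).
  by move=> p /DK; rewrite inE.
by move=> x /cover[p /= pD]; rewrite ballEmdist => px; exists p.
Qed.

Definition close_center (delta : R) (x0 : X) (ps : seq X) (x : X) : X :=
  foldr (fun p q => if mdist p x < delta then p else q) x0 ps.

Lemma close_center_mem delta x0 ps x :
  close_center delta x0 ps x \in x0 :: ps.
Proof.
elim: ps => [|p ps IH] /=; first exact: mem_head.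
case: ifP => _; rewrite !inE ?eqxx ?orbT//.
by move: IH; rewrite inE => /orP[->|->]; rewrite ?orbT.
Qed.

Lemma close_centerP delta x0 ps x :
  (exists2 p, p \in ps & mdist p x < delta) ->
  close_center delta x0 ps x \in ps /\
  mdist (close_center delta x0 ps x) x < delta.
Proof.
elim: ps => [[]//|p ps IH] [q]; rewrite inE => qps qx /=.
case: ifPn => px; first by rewrite mem_head.
move: qps => /predU1P[qp|qps]; first by rewrite -qp qx in px.
by have [|? ?] := IH; [exists q | split => //; rewrite inE; apply/orP; right].
Qed.

(** Taking only finitely many values on Borel pieces, the selection of a centre
    stays measurable after composition with an arbitrary function. *)
Lemma measurable_close_center d (Y : measurableType d) (phi : X -> Y)
    delta x0 ps :
  measurable_fun [set: borel X]
    (fun x : borel X => phi (close_center delta x0 ps x)).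
Proof.
elim: ps => [|p ps IH].
  exact: (@measurable_cst _ _ (borel X) Y setT (phi x0)).
rewrite (_ : (fun x : borel X => _) = fun x : borel X => if mdist p x < delta
    then phi p else phi (close_center delta x0 ps x)); last first.
  by apply/funext => x /=; case: ifP.
apply: measurable_fun_ifT => //.
apply: (@measurable_fun_bool _ _ _ _ true); rewrite setTI.
rewrite (_ : _ @^-1` _ = ball p delta); last first.
  by rewrite ballEmdist; apply/seteqP; split => x /=.
by apply: measurable_open; exact: open_metric_ball.
Qed.

(** * Iterates of a measure-preserving map *)

Section Invariance.
Context (mu : probability (borel X) R) (T : X -> X).
Hypothesis mT : measurable_fun [set: borel X] (T : borel X -> borel X).

Lemma measurable_iter n :
  measurable_fun [set: borel X] (iter n T : borel X -> borel X).
Proof.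
elim: n => [|n IH]; first exact: measurable_id.
exact: (measurableT_comp mT IH).
Qed.

Lemma integral_iter (muT : invariant_measure T mu) n (g : borel X -> \bar R) :
  measurable_fun setT g -> (forall x, 0 <= g x)%E ->
  (\int[mu]_x g (iter n T x) = \int[mu]_x g x)%E.
Proof.
elim: n g => [//|n IH] g mg g0.
under eq_integral do rewrite iterS.
rewrite (IH (g \o T)); last by move=> x; exact: g0.
  2: exact: (measurableT_comp mg mT).
have /= <- := ge0_integral_pushforward mT mu measurableT mg (fun y _ => g0 y).
by apply: eq_measure_integral => A mA _; exact: muT.
Qed.

End Invariance.
End Borel.

(** * Discretization of bounded values *)

Section Levels.
Context {R : realType}.

(** The index of the interval of length [eta], counted from [- M], that contains
    [v]; meaningful for [|v| <= M] only, the values of [inord] above [M] being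
    arbitrary. *)
Definition level (M eta v : R) : 'I_(Num.truncn (2 * M / eta)).+1 :=
  inord (Num.truncn ((v + M) / eta)).

Lemma level_close (M eta v w : R) : 0 < eta -> `|v| <= M -> `|w| <= M ->
  level M eta v = level M eta w -> `|v - w| <= eta.
Proof.
move=> eta0.
have itv u : `|u| <= M -> 0 <= (u + M) / eta /\
    (Num.truncn ((u + M) / eta) < (Num.truncn (2 * M / eta)).+1)%N.
  rewrite ler_norml => /andP[Mu uM]; split; first by rewrite divr_ge0; lra.
  by rewrite ltnS le_truncn// ler_pM2r ?invr_gt0//; lra.
move=> /itv[v0 vL] /itv[w0 wL] /(congr1 val) /=; rewrite !inordK// => vw.
have /andP[] := truncn_itv v0; have /andP[] := truncn_itv w0; rewrite vw.
set k := Num.truncn _; rewrite -natr1 !ler_pdivlMr// !ltr_pdivrMr// => *.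
by rewrite ler_norml; apply/andP; split; nra.
Qed.

End Levels.

(** * Returns of bounded observables *)

Section BoundedObservables.
Context {R : realType} {X : pmetricType R} {I : finType}.
Context (mu : probability (borel X) R) (T : X -> X).
Hypothesis mT : measurable_fun [set: borel X] (T : borel X -> borel X).
Hypothesis muT : invariant_measure T mu.

(** A finite family of real observables is seen as one observable with values in
    [R^I], here with its l^1 distance; complex functions are the case of two
    observables, which have to return at the same times. *)
Definition obs_dist (h : I -> X -> R) (x y : X) : R :=
  \sum_b `|h b x - h b y|.

(** Bounding the averages eventually, instead of their upper limit, makes the
    property pass to observables with smaller distances and to constant
    multiples by filter reasoning. *)
Definition obs_mean_equicontinuous (a : nat -> nat) (h : I -> X -> R) : Prop :=
  forall tau : R, 0 < tau -> exists K : set X, [/\ compact K,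
    forall e : R, 0 < e -> exists2 delta : R, 0 < delta &
      forall x y, K x -> K y -> mdist x y < delta ->
      \forall n \near \oo, n%:R^-1 * (\sum_(i < n)
        obs_dist h (iter (a i) T x) (iter (a i) T y)) <= e
    & ((1 - tau)%:E < mu K)%E].

Lemma obs_dist_ge0 h x y : 0 <= obs_dist h x y.
Proof. by rewrite sumr_ge0. Qed.

Lemma obs_dist_triangle h x y z :
  obs_dist h x z <= obs_dist h x y + obs_dist h y z.
Proof.
rewrite -big_split; apply: ler_sum => b _; exact: ler_distD.
Qed.

Lemma obs_distC h x y : obs_dist h x y = obs_dist h y x.
Proof. by apply: eq_bigr => b _; rewrite distrC. Qed.

Lemma obs_dist_le h (e : R) x y :
  (forall b, `|h b x - h b y| <= e) -> obs_dist h x y <= #|I|%:R * e.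
Proof.
move=> he; rewrite (le_trans (ler_sum _ (fun b _ => he b)))//.
by rewrite sumr_const mulr_natl.
Qed.

Lemma measurable_obs_dist h (phi psi : X -> X) :
  (forall b, measurable_fun [set: borel X] (fun x : borel X => h b (phi x))) ->
  (forall b, measurable_fun [set: borel X] (fun x : borel X => h b (psi x))) ->
  measurable_fun [set: borel X] (fun x : borel X => obs_dist h (phi x) (psi x)).
Proof.
move=> mphi mpsi; apply: (@measurable_sum _ (borel X) R setT I (index_enum I)
  (fun b x => `|h b (phi x) - h b (psi x)|)) => b.
apply: measurableT_comp => //; exact: measurable_funB.
Qed.

(** Infinitely many iterates [h o T^(a_i)] are [L^1]-close to functions given by
    their values at the centres of one finite net of [K].  Hence finitely many
    small [L^1]-balls cover these iterates, two of distant indices are close,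
    and invariance of [mu] turns their distance into the one between [h o T^t]
    and [h], where [t = a_j - a_i]. *)
Lemma bounded_return (a : nat -> nat) (h : I -> X -> R) (M : R) :
  increasing_seq a ->
  (forall b, measurable_fun [set: borel X] (h b : borel X -> R)) ->
  0 < M -> (forall b x, `|h b x| <= M) ->
  obs_mean_equicontinuous a h ->
  forall e : R, 0 < e -> forall N, exists2 t, (N <= t)%N &
    (\int[mu]_x (obs_dist h (iter t T x) x)%:E <= e%:E)%E.
Proof.
move=> inca mh M0 hM equi e e0 N.
pose B := #|I|%:R * (2 * M).
have B0 : 0 <= B by rewrite mulr_ge0// mulr_ge0// ltW.
have distB x y : obs_dist h x y <= B.
  apply: obs_dist_le => b; rewrite (le_trans (ler_normB _ _))//.
  by have := hM b x; have := hM b y; lra.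
(* 13 = 6 + 6 + 1: a small average gives a pair of terms at most [2 * 3 * eps]
   each, and the values at the centres differ by at most [eps] *)
pose eps := e / 13; have eps0 : 0 < eps by rewrite divr_gt0.
pose eta := eps / (#|I|%:R + 1).
have eta0 : 0 < eta by rewrite divr_gt0// ltr_wpDl.
pose tau := eps / (B + 1).
have tau0 : 0 < tau by rewrite divr_gt0// ltr_wpDl.
have Btau : B * tau <= eps.
  by rewrite /tau mulrCA ger_pMr// ler_pdivrMr ?mul1r; lra.
have Ieta : #|I|%:R * eta <= eps.
  have : 0 <= #|I|%:R :> R by [].
  by move=> ?; rewrite /eta mulrCA ger_pMr// ler_pdivrMr ?mul1r; lra.
have [K [cK equiK muK]] := equi _ tau0.
have [delta delta0 close] := equiK _ eps0.
have [ps psK net] := compact_finite_net cK delta0.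
(* the default centre [point] need not lie in [K], but is used off [K] only *)
pose s := close_center delta point ps.
have sP x : K x -> K (s x) /\ mdist (s x) x < delta.
  by move=> Kx; have [/psK] := close_centerP point (net x Kx).
have mhT b n : measurable_fun [set: borel X]
    (fun x : borel X => h b (iter n T x)).
  exact: (measurableT_comp (mh b) (measurable_iter mT n)).
have mhs b n : measurable_fun [set: borel X]
    (fun x : borel X => h b (iter n T (s x))).
  exact: (measurable_close_center (fun x => h b (iter n T x))).
pose D i x := obs_dist h (iter (a i) T x) (iter (a i) T (s x)).
have mD i : measurable_fun [set: borel X] (D i : borel X -> R).
  exact: measurable_obs_dist.
have mDE i : measurable_fun [set: borel X] (EFin \o D i : borel X -> \bar R).
  exact/measurable_EFinP.
pose F n x := n%:R^-1 * \sum_(i < n) D i x.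
have mF n : measurable_fun [set: borel X] (F n : borel X -> R).
  apply: measurable_funM => //.
  exact: (@measurable_sum _ (borel X) R setT _ _ (fun i : 'I_n => D i)).
have FB n x : 0 <= F n x <= B.
  rewrite mulr_ge0 ?invr_ge0 ?sumr_ge0//= => [|i _]; last exact: obs_dist_ge0.
  case: n => [|n]; first by rewrite /F invr0 mul0r.
  rewrite ler_pdivrMl ?ltr0n//.
  rewrite (le_trans (ler_sum _ (fun (i : 'I_n.+1) _ => distB _ _)))//.
  by rewrite sumr_const card_ord mulr_natl.
have [n0 _ intF] : \forall n \near \oo,
    (\int[mu]_x (F n x)%:E <= (2 * eps + B * tau)%:E)%E.
  apply: (@eventually_le_integral _ (borel X) R mu F B eps tau K) => //.
    exact: measurable_compact.
  move=> x Kx; have [Ks sx] := sP x Kx; have := close _ _ Ks Kx sx.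
  apply: filterS => n; under eq_bigr do rewrite obs_distC.
  exact.
pose c i := (\int[mu]_x (D i x)%:E)%E.
have c0 i : (0 <= c i)%E.
  by apply: integral_ge0 => x _; rewrite lee_fin obs_dist_ge0.
have csmall : forall N', exists2 i, (N' <= i)%N & (c i <= (2 * (3 * eps))%:E)%E.
  apply: frequently_le_of_averages => //; first by rewrite mulr_gt0.
  exists n0.+1 => // n /= n0n.
  rewrite -(ge0_integral_sum mu measurableT
    (f := fun i : 'I_n => EFin \o D i))//; last first.
    by move=> i x _; rewrite lee_fin obs_dist_ge0.
  under eq_integral => x _.
    rewrite sumEFin (_ : \sum_(i < n) D i x = n%:R * F n x); last first.
      by rewrite mulrA divff ?mul1r// pnatr_eq0 -lt0n (leq_trans _ n0n).
    rewrite EFinM; over.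
  rewrite ge0_integralZl_EFin//; last 2 first.
  - by move=> x _; rewrite lee_fin; have /andP[] := FB n x.
  - exact/measurable_EFinP.
  rewrite EFinM lee_wpmul2l ?lee_fin//.
  by rewrite (le_trans (intF n (ltnW n0n)))// lee_fin; lra.
(* the discretized values of [h o T^(a_i)] at all centres, default included *)
pose color i : {ffun 'I_(size ps).+1 * I -> _} :=
  [ffun pb : 'I_(size ps).+1 * I =>
    level M eta (h pb.2 (iter (a i) T (nth point (point :: ps) pb.1)))].
have [i [j [ci cj colij ij]]] := distant_pair_same_color color csmall N.
have [aij Naij] : (a i <= a j)%N /\ (N <= a j - a i)%N.
  have : (a i + N <= a j)%N.
    rewrite (leq_trans _ (_ : (a (i + N)%N <= a j)%N))//; last first.
      by rewrite -leEnat inca.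
    elim: N {ij csmall colij} => [|m IH]; first by rewrite !addn0.
    rewrite !addnS (leq_ltn_trans IH)//.
    by have := (increasing_seqP a).2 inca (i + m)%N; rewrite ltEnat.
  move=> aN; split; last by rewrite leq_subRL// (leq_trans _ aN)// leq_addr.
  by rewrite (leq_trans _ aN)// leq_addr.
exists (a j - a i)%N => //.
rewrite -(integral_iter mT muT (a i)); last 2 first.
- apply/measurable_EFinP; apply: measurable_obs_dist => // b.
- by move=> x; rewrite lee_fin obs_dist_ge0.
under eq_integral do rewrite -iterD subnK//.
apply: (@le_trans _ _ (\int[mu]_x ((D j x)%:E + ((D i x)%:E + eps%:E)))%E).
  apply: ge0_le_integral => //.
  - by move=> x _; rewrite lee_fin obs_dist_ge0.
  - by apply/measurable_EFinP; exact: measurable_obs_dist.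
  - exact: emeasurable_funD (mDE j)
      (emeasurable_funD (mDE i) (measurable_cst _)).
  move=> x _; rewrite -!EFinD lee_fin.
  apply: (le_trans (obs_dist_triangle _ _ (iter (a j) T (s x)) _)).
  apply: lerD; first exact: lexx.
  apply: (le_trans (obs_dist_triangle _ _ (iter (a i) T (s x)) _)).
  rewrite [leRHS]addrC; apply: lerD; last by rewrite obs_distC; exact: lexx.
  apply: (le_trans _ Ieta).
  apply: obs_dist_le => b; apply: (level_close eta0) => //.
  have k_lt : (index (s x) (point :: ps) < (size ps).+1)%N.
    by rewrite -[(size ps).+1]/(size (point :: ps)) index_mem close_center_mem.
  pose k := Ordinal k_lt.
  have kE : nth point (point :: ps) k = s x.
    exact/nth_index/close_center_mem.
  by have /ffunP/(_ (k, b)) := colij; rewrite !ffunE [_.1]/= [_.2]/= kE.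
rewrite ge0_integralD//; last 4 first.
- by move=> x _; rewrite lee_fin obs_dist_ge0.
- exact: mDE.
- by move=> x _; rewrite adde_ge0// lee_fin ?obs_dist_ge0// ltW.
- exact: (emeasurable_funD (mDE i) (measurable_cst _)).
rewrite ge0_integralD//; last 3 first.
- by move=> x _; rewrite lee_fin obs_dist_ge0.
- exact: mDE.
- by move=> x _; rewrite lee_fin ltW.
rewrite integral_cst// [X in (eps%:E * X)%E](_ : _ = 1%E); last first.
  exact: probability_setT.
rewrite mule1 (le_trans (leeD cj (leeD2r _ ci)))// -!EFinD lee_fin /eps; lra.
Qed.

End BoundedObservables.

(** * Truncation and square-integrable observables *)

Section Truncation.
Context {R : realType}.
Implicit Types M v w : R.

Definition trunc M v : R := Num.max (- M) (Num.min M v).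

Lemma normr_trunc M v : 0 <= M -> `|trunc M v| <= M.
Proof.
move=> M0; rewrite ler_norml /trunc le_max lexx /= ge_max ge_min lexx andbT.
by lra.
Qed.

Lemma trunc_id M v : `|v| <= M -> trunc M v = v.
Proof.
rewrite ler_norml => /andP[Mv vM].
by rewrite /trunc (min_idPr vM); exact/max_idPr.
Qed.

Lemma trunc_lipschitz M v w : `|trunc M v - trunc M w| <= `|v - w|.
Proof.
wlog vw : v w / v <= w => [sym|].
  by have [/sym//|/ltW/sym] := leP v w; rewrite distrC [leRHS]distrC.
rewrite distrC [leRHS]distrC [leRHS]ger0_norm ?subr_ge0// ler_norml /trunc.
case: (leP M v) => ?; case: (leP M w) => ?;
  do 2?[case: (leP (- M) _) => ?]; apply/andP; split; lra.
Qed.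

Lemma trunc_defect_le M v : 0 <= M -> (v - trunc M v) ^+ 2 <= v ^+ 2.
Proof.
move=> M0; rewrite -[leLHS]real_normK ?num_real//.
rewrite -[leRHS]real_normK ?num_real//.
rewrite ler_pXn2r ?nnegrE// ler_norml /trunc.
have /andP[? ?] : - `|v| <= v <= `|v| by rewrite -ler_norml.
by case: (leP M v) => ?; case: (leP (- M) _) => ?; apply/andP; split; lra.
Qed.

Lemma measurable_trunc d (T : measurableType d) M (g : T -> R) :
  measurable_fun setT g -> measurable_fun setT (fun x => trunc M (g x)).
Proof. by move=> mg; apply: measurable_maxr => //; apply: measurable_minr. Qed.

(** Write [w - v] as the sum of the two truncation defects and of the difference
    [d] of the truncated values; since [|d| <= 2 * M], its square is at most
    [2 * M * |d|]. *)
Lemma trunc_square_bound M v w : 0 <= M ->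
  (w - v) ^+ 2 <= 3 * (w - trunc M w) ^+ 2 + 3 * (v - trunc M v) ^+ 2
    + 6 * M * `|trunc M w - trunc M v|.
Proof.
move=> M0; set p := trunc M w; set q := trunc M v.
have pM : `|p| <= M by exact: normr_trunc.
have qM : `|q| <= M by exact: normr_trunc.
have pq : (p - q) ^+ 2 <= 2 * M * `|p - q|.
  rewrite -real_normK ?num_real// expr2 ler_wpM2r//.
  by rewrite (le_trans (ler_normB _ _))//; lra.
have -> : w - v = (w - p) - (v - q) + (p - q) by ring.
have := sqr_ge0 ((w - p) + (v - q)); have := sqr_ge0 ((w - p) - (p - q)).
by have := sqr_ge0 ((v - q) + (p - q)); nra.
Qed.

End Truncation.

Section SquareIntegrable.
Context {R : realType} {I : finType}.

(** Dominated convergence: at each point the defect vanishes as soon as [M]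
    exceeds the values there, and it is dominated by the square itself. *)
Lemma truncation_defect_small d (T : measurableType d) (P : probability T R)
    (u : I -> T -> R) :
  (forall b, measurable_fun setT (u b)) ->
  (\int[P]_x (\sum_b (u b x) ^+ 2)%:E < +oo)%E ->
  forall e : R, 0 < e -> exists2 M, 0 < M &
    (\int[P]_x (\sum_b (u b x - trunc M (u b x)) ^+ 2)%:E <= e%:E)%E.
Proof.
move=> meas_u ufin e e0.
pose r (n : nat) x := \sum_b (u b x - trunc n.+1%:R (u b x)) ^+ 2.
pose q x := \sum_b (u b x) ^+ 2.
have mr n : measurable_fun setT (r n).
  apply: measurable_sum => b; apply: measurable_funX.
  by apply: measurable_funB => //; exact: measurable_trunc.
have mq : measurable_fun setT q.
  by apply: measurable_sum => b; exact: measurable_funX.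
have q0 x : 0 <= q x by apply: sumr_ge0 => b _; exact: sqr_ge0.
have r0 n x : 0 <= r n x by apply: sumr_ge0 => b _; exact: sqr_ge0.
have rq n x : r n x <= q x by apply: ler_sum => b _; exact: trunc_defect_le.
have cvgr x : (r n x)%:E @[n --> \oo] --> 0%E.
  apply: cvg_near_cst; near=> n; apply/eqP; rewrite eqe; apply/eqP.
  rewrite /r big1// => b _; rewrite trunc_id ?subrr ?expr0n//.
  have : \sum_c `|u c x| <= n.+1%:R.
    rewrite (le_trans (ltW (truncnS_gt _)))// ler_nat ltnS.
    by near: n; exact: nbhs_infty_ge.
  by apply: le_trans; rewrite (bigD1 b)//= lerDl sumr_ge0.
have cvgI : (\int[P]_x (r n x)%:E)%E @[n --> \oo] --> 0%E.
  rewrite -[X in _ --> X](integral0 P setT).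
  apply: (@dominated_cvg _ _ _ P setT _ _ _ (EFin \o q)) => //.
  - by move=> n; exact/measurable_EFinP.
  - apply/integrableP; split; first exact/measurable_EFinP.
    by under eq_integral do rewrite gee0_abs ?lee_fin//.
  - by move=> n x _ /=; rewrite lee_fin ger0_norm.
have [n _ small] : \forall n \near \oo, (\int[P]_x (r n x)%:E < e%:E)%E.
  apply: (cvgI [set y | (y < e%:E)%E]); apply: open_nbhs_nbhs.
  by split; [exact: open_ereal_lt_ereal | rewrite /= lte_fin].
by exists n.+1%:R => //; exact/ltW/(small n)/leqnn.
Unshelve. all: by end_near.
Qed.

Context {X : pmetricType R}.
Context (mu : probability (borel X) R) (T : X -> X).
Hypothesis mT : measurable_fun [set: borel X] (T : borel X -> borel X).
Hypothesis muT : invariant_measure T mu.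

(** Truncation is 1-Lipschitz, so the truncated observables remain mean
    equicontinuous and [bounded_return] applies to them; their [L^1] returns
    give [L^2] returns of [u] by [trunc_square_bound], the two defects having
    equal integrals by invariance. *)
Lemma square_integrable_return (a : nat -> nat) (u : I -> X -> R) :
  increasing_seq a ->
  (forall b, measurable_fun [set: borel X] (u b : borel X -> R)) ->
  (\int[mu]_x (\sum_b (u b x) ^+ 2)%:E < +oo)%E ->
  obs_mean_equicontinuous mu T a u ->
  forall e : R, 0 < e -> forall N, exists2 t, (N <= t)%N &
    (\int[mu]_x (\sum_b (u b (iter t T x) - u b x) ^+ 2)%:E <= e%:E)%E.
Proof.
move=> inca meas_u ufin equi e e0 N.
(* [e] is split as 3 * (e / 12) for each of the two defects and
   6 * M * (e / (12 * M)) for the truncated observables *)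
have e12 : 0 < e / 12 by rewrite divr_gt0.
have [M M0 rsmall] := truncation_defect_small meas_u ufin e12.
pose h b x := trunc M (u b x).
have mh b : measurable_fun [set: borel X] (h b : borel X -> R).
  exact: (measurable_trunc M (meas_u b)).
have hu x y : obs_dist h x y <= obs_dist u x y.
  by apply: ler_sum => b _; exact: trunc_lipschitz.
have [|tau tau0||t Nt ht] := @bounded_return R X I mu T mT muT a h M inca mh M0
    _ _ (e / (12 * M)) _ N.
- by move=> b x; rewrite normr_trunc// ltW.
- have [K [cK equiK muK]] := equi _ tau0; exists K; split=> // e' e'0.
  have [delta delta0 close] := equiK _ e'0; exists delta => // x y Kx Ky xy.
  have := close x y Kx Ky xy; apply: filterS => n; apply: le_trans.
  by rewrite ler_wpM2l ?invr_ge0//; apply: ler_sum.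
- by rewrite divr_gt0// mulr_gt0.
exists t => //.
pose r x := \sum_b (u b x - h b x) ^+ 2.
have mr : measurable_fun [set: borel X] (r : borel X -> R).
  apply: (@measurable_sum _ (borel X) R setT I (index_enum I)
    (fun b x => (u b x - h b x) ^+ 2)) => b.
  by apply: measurable_funX; exact: measurable_funB.
have r0 x : 0 <= r x by apply: sumr_ge0 => b _; exact: sqr_ge0.
have mTt := measurable_iter mT t.
have mrT : measurable_fun [set: borel X] (fun x : borel X => r (iter t T x)).
  exact: (measurableT_comp mr mTt).
have mD : measurable_fun [set: borel X]
    (fun x : borel X => obs_dist h (iter t T x) x).
  apply: (measurable_obs_dist (phi := iter t T) (psi := id)) => b //.
  exact: (measurableT_comp (mh b) mTt).
have mS : measurable_fun [set: borel X]
    (fun x : borel X => \sum_b (u b (iter t T x) - u b x) ^+ 2).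
  apply: (@measurable_sum _ (borel X) R setT I (index_enum I)
    (fun b x => (u b (iter t T x) - u b x) ^+ 2)) => b.
  apply: measurable_funX; apply: measurable_funB => //.
  exact: (measurableT_comp (meas_u b) mTt).
have mZ (k : R) (g : borel X -> R) : measurable_fun [set: borel X] g ->
    measurable_fun [set: borel X] (fun x => k%:E * (g x)%:E)%E.
  by move=> mg; apply: measurable_funeM; exact/measurable_EFinP.
apply: (@le_trans _ _ (\int[mu]_x (3%:E * (r (iter t T x))%:E
   + (3%:E * (r x)%:E + (6 * M)%:E * (obs_dist h (iter t T x) x)%:E)))%E).
  apply: ge0_le_integral => //.
  - by move=> x _; rewrite lee_fin sumr_ge0// => b _; exact: sqr_ge0.
  - exact/measurable_EFinP.
  - exact: emeasurable_funD (mZ _ _ mrT)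
      (emeasurable_funD (mZ _ _ mr) (mZ _ _ mD)).
  move=> x _; rewrite -!EFinM -!EFinD lee_fin.
  rewrite /r /obs_dist !mulr_sumr -!big_split; apply: ler_sum => b _ /=.
  by rewrite addrA trunc_square_bound// ltW.
have three0 : (0 <= 3 :> R) by [].
have sixM0 : 0 <= 6 * M by rewrite mulr_ge0// ltW.
rewrite ge0_integralD//; last 4 first.
- by move=> x _; rewrite -EFinM lee_fin mulr_ge0.
- exact: mZ.
- by move=> x _; rewrite adde_ge0// -EFinM lee_fin mulr_ge0// obs_dist_ge0.
- exact: (emeasurable_funD (mZ _ _ mr) (mZ _ _ mD)).
rewrite ge0_integralD//; last 4 first.
- by move=> x _; rewrite -EFinM lee_fin mulr_ge0.
- exact: mZ.
- by move=> x _; rewrite -EFinM lee_fin mulr_ge0// obs_dist_ge0.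
- exact: mZ.
rewrite !ge0_integralZl_EFin//; last 6 first.
- by move=> x _; rewrite lee_fin obs_dist_ge0.
- exact/measurable_EFinP.
- by move=> x _; rewrite lee_fin.
- exact/measurable_EFinP.
- by move=> x _; rewrite lee_fin.
- exact/measurable_EFinP.
rewrite (integral_iter mT muT t (g := fun x => (r x)%:E)); last 2 first.
- exact/measurable_EFinP.
- by move=> x; rewrite lee_fin.
apply: (@le_trans _ _ (3%:E * (e / 12)%:E + (3%:E * (e / 12)%:E +
    (6 * M)%:E * (e / (12 * M))%:E))%E).
  by rewrite !leeD// lee_wpmul2l// lee_fin.
rewrite -!EFinM -!EFinD lee_fin.
have -> : 6 * M * (e / (12 * M)) = e / 2 by field; rewrite gt_eqF.
lra.
Qed.

End SquareIntegrable.

(** * Rigidity *)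

Lemma increasing_selection (Q : nat -> nat -> Prop) :
  (forall k N, exists2 t, (N <= t)%N & Q k t) ->
  exists2 t : nat -> nat, increasing_seq t & forall k, Q k (t k).
Proof.
move=> exQ; have /choice[g gP] (kN : nat * nat) :
    exists t, (kN.2 <= t)%N /\ Q kN.1 t.
  by have [t] := exQ kN.1 kN.2; exists t.
pose t := fix t k := if k is k'.+1 then g (k, (t k').+1) else g (0%N, 0%N).
exists t => [|[|k]]; last 2 first.
- by have [] := gP (0%N, 0%N).
- by have [] := gP (k.+1, (t k).+1).
by apply/increasing_seqP => k; rewrite ltEnat; have [] := gP (k.+1, (t k).+1).
Qed.

Lemma limn_esup_lt_near (R : realType) (u : nat -> R) (l : R) :
  (limn_esup (fun n => (u n)%:E) < l%:E)%E -> \forall n \near \oo, u n < l.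
Proof.
move=> /ereal_inf_lt[_ [V Voo <-] supl]; apply: filterS Voo => n Vn.
rewrite -lte_fin (le_lt_trans _ supl)//; apply: ereal_sup_ubound.
by exists n.
Qed.

Section ComplexObservable.
Context {R : realType}.

(** The pair of real observables that stands for [f] in the lemmas on finite
    families. *)
Definition re_im {X : Type} (f : X -> R[i]) (b : bool) (x : X) : R :=
  if b then complex.Re (f x) else complex.Im (f x).

Lemma sqr_normc_ReIm (z : R[i]) :
  ComplexField.Normc.normc z ^+ 2 = complex.Re z ^+ 2 + complex.Im z ^+ 2.
Proof. by case: z => p q /=; rewrite sqr_sqrtr// addr_ge0 ?sqr_ge0. Qed.

Lemma normc_ge0 (z : R[i]) : 0 <= ComplexField.Normc.normc z.
Proof. by case: z => p q /=; exact: sqrtr_ge0. Qed.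

Lemma normr_ReIm_le (z : R[i]) :
  `|complex.Re z| + `|complex.Im z| <= 2 * ComplexField.Normc.normc z.
Proof.
have le_normc (v w : R) : v ^+ 2 + w ^+ 2 = ComplexField.Normc.normc z ^+ 2 ->
    `|v| <= ComplexField.Normc.normc z.
  move=> vw; rewrite -(@ler_pXn2r _ 2)// ?nnegrE// ?normc_ge0//.
  by rewrite real_normK ?num_real// -vw lerDl sqr_ge0.
have := le_normc _ _ (esym (sqr_normc_ReIm z)).
have := le_normc (complex.Im z) (complex.Re z).
by rewrite addrC -sqr_normc_ReIm => /(_ erefl); lra.
Qed.

Lemma obs_dist_re_im {X : pmetricType R} (f : X -> R[i]) x y :
  obs_dist (re_im f) x y <= 2 * ComplexField.Normc.normc (f x - f y).
Proof.
rewrite /obs_dist big_bool /=; apply: le_trans (normr_ReIm_le _).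
by case: (f x) (f y) => [? ?] [? ?].
Qed.

Lemma L2normE {X : pmetricType R} (mu : probability (borel X) R)
    (f : X -> R[i]) :
  L2norm mu f =
  ((\int[mu]_x (\sum_b (re_im f b x) ^+ 2)%:E) `^ (2^-1))%E.
Proof.
rewrite /L2norm unlock; congr (_ `^ _)%E; apply: eq_integral => x _.
rewrite abse_EFin poweR_EFin ger0_norm ?normc_ge0//.
by rewrite powR_mulrn ?normc_ge0// sqr_normc_ReIm big_bool.
Qed.

End ComplexObservable.

Unset Implicit Arguments.
Set Strict Implicit.

Theorem theorem4p9 (R : realType) (X : pmetricType R)
  (compactX : compact [set: X]) (T : X -> X) (homeoT : homeomorphism T)
  (mu : probability (borel X) R) (muT : invariant_probability T mu)
  (f : X -> R[i]) (fL2 : L2 mu f) :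
  (exists a : nat -> nat,
     [/\ increasing_seq a, (0 < upper_density R (range a))%E
       & mean_equicontinuous T mu f a]) ->
  rigid T mu f.
Proof.
move=> [a [inca _ equi]].
have mT : measurable_fun [set: borel X] (T : borel X -> borel X).
  by have [S [_ _ cT _]] := homeoT; exact: measurable_continuous.
have [mRe mIm fin] := fL2.
have meas_u b : measurable_fun [set: borel X] (re_im f b : borel X -> R).
  by case: b; [exact: mRe | exact: mIm].
have ufin : (\int[mu]_x (\sum_b (re_im f b x) ^+ 2)%:E < +oo)%E.
  by move: fin; rewrite L2normE; apply: lty_poweRy; rewrite invr_eq0.
have uequi : obs_mean_equicontinuous mu T a (re_im f).
  move=> tau tau0; have [K [cK equiK muK]] := equi _ tau0.
  exists K; split=> // e e0.
  have [|delta delta0 close] := equiK (e / 2); first by rewrite divr_gt0.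
  exists delta => // x y Kx Ky xy.
  apply: filterS (limn_esup_lt_near (close x y Kx Ky xy)) => n.
  rewrite ltr_pdivlMr// => /ltW; apply: le_trans.
  rewrite /dbar -mulrA ler_wpM2l ?invr_ge0// mulr_suml.
  by apply: ler_sum => i _; rewrite mulrC obs_dist_re_im.
have returns := square_integrable_return mT muT.2 inca meas_u ufin uequi.
have [|t inct tP] := @increasing_selection (fun k t =>
    (L2norm mu (fun x => f (iter t T x) - f x)%R <= (k.+1%:R^-1)%:E)%E).
  move=> k N; have [|t Nt tk] := returns (k.+1%:R^-1 ^+ 2) _ N.
    by rewrite exprn_gt0.
  exists t => //; rewrite L2normE.
  have -> : ((k.+1%:R^-1)%:E = ((k.+1%:R^-1 ^+ 2 : R)%:E `^ 2^-1) :> \bar R)%E.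
    by rewrite poweR_EFin powR12_sqrt ?sqr_ge0// sqrtr_sqr ger0_norm.
  apply: gt0_ler_poweR => //.
  - rewrite in_itv /= leey andbT integral_ge0// => x _.
    by rewrite lee_fin sumr_ge0// => b _; exact: sqr_ge0.
  - by rewrite in_itv /= leey andbT lee_fin sqr_ge0.
  - apply: le_trans tk; rewrite le_eqVlt; apply/orP; left; apply/eqP.
    apply: eq_integral => x _; congr EFin; apply: eq_bigr => b _.
    congr (_ ^+ 2); case: b; rewrite /re_im;
      by case: (f _) (f x) => [? ?] [? ?].
exists t => //.
apply: (@squeeze_cvge _ _ _ _ (cst 0%E) _ (fun k => (k.+1%:R^-1)%:E)).
- by apply: nearW => k; rewrite tP /L2norm Lnorm_ge0.
- exact: cvg_cst.
- by apply: cvg_EFin; [exact: nearW | exact: cvg_harmonic].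
Qed.
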